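(* Let $\mathbb{P}\subseteq\mathbb{R}^{n_\mathrm{p}}$ and consider the LPV state-space model $$\begin{bmatrix} x_{t+1}\\ y_t\end{bmatrix}=\begin{bmatrix}A(p_t)&B(p_t)\\ C(p_t)&D(p_t)\end{bmatrix}\begin{bmatrix} x_t \\ u_t \end{bmatrix}+b(p_t),\qquad p_t\in\mathbb{P},$$ defined by the coefficient function $\psi_\theta: p\in\mathbb{P}\mapsto (A(p),B(p),C(p),D(p),b(p))$. The model satisfies the condition (there exist a symmetric matrix $\mathcal{X}\succ 0$ in $\mathbb{R}^{n_\mathrm{x}\times n_\mathrm{x}}$ and $\alpha\in(0,1]$ such that) $\quad\alpha^2\mathcal{X}-A(p)^\top\mathcal{X}A(p)\succ 0$ for all $p\in\mathbb{P}$ if and only if there exist $d\in\mathbb{R}^{n_\mathrm{x}}$, $\alpha\in(0,1]$, $\mathcal{Y}\in\mathbb{R}^{n_\mathrm{x}\times n_\mathrm{x}}$ and a mapping $\phi:p\mapsto (X(p),Y(p))$ on $\mathbb{P}$ with $X(p),Y(p)\in\mathbb{R}^{n_\mathrm{x}\times n_\mathrm{x}}$ such that, for all $p\in\mathbb{P}$, $$A(p)=\alpha\, Q\Lambda^{-1}M(p)\Lambda Q^\top,$$ with $\Lambda=\mathrm{diag}(e^{d})$ and $$Q=\mathrm{Cayley}(\mathcal{Y}-\mathcal{Y}^\top),\qquad M(p)=\mathrm{Cayley}(N(p)),$$ where $N(p)=X(p)^\top X(p)+Y(p)-Y(p)^\top+\epsilon I$ for some small positive constant $\epsilon$.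
   Context: All matrices are real. For a square matrix $M$ with $I+M$ invertible, $\mathrm{Cayley}(M):=(I-M)(I+M)^{-1}$. For $d=(d_1,\dots,d_n)\in\mathbb{R}^n$, $\mathrm{diag}(e^d)$ is the diagonal matrix with diagonal entries $e^{d_1},\dots,e^{d_n}$. $S\succ 0$ means that $S$ is symmetric positive definite. The dimensions are $x_t\in\mathbb{R}^{n_\mathrm{x}}$, $u_t\in\mathbb{R}^{n_\mathrm{u}}$, $y_t\in\mathbb{R}^{n_\mathrm{y}}$, $p_t\in\mathbb{P}\subseteq\mathbb{R}^{n_\mathrm{p}}$ (state, input, output and scheduling signal); $A,B,C,D$ are matrix-valued functions and $b$ a vector-valued function on $\mathbb{P}$ of compatible sizes, with $A(p)\in\mathbb{R}^{n_\mathrm{x}\times n_\mathrm{x}}$.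
   Formalization: The positive constant ε may depend on p (chosen at each p like X(p), Y(p)); with a single ε for all p the ''only if'' part fails, e.g. P=(0,1), A(p)=p, which satisfies the condition with 𝒳=α=1. *)

(* Defs.v *)
From HB Require Import structures.
From mathcomp Require Import all_boot all_order all_algebra.
From mathcomp Require Import all_classical all_reals all_analysis.

Set Implicit Arguments.
Unset Strict Implicit.
Unset Printing Implicit Defensive.

Import Order.TTheory GRing.Theory Num.Theory.
Local Open Scope ring_scope.

Definition posdefmx (R : realType) (n : nat) (S : 'M[R]_n) : Prop :=
  S \is symmetricmx /\
  forall v : 'cV[R]_n, v != 0 -> 0 < (v^T *m S *m v) 0 0.

(* Meaningful when 1 + M is invertible: invmx is the identity on singular
   matrices. *)
Definition cayley (R : realType) (n : nat) (M : 'M[R]_n) : 'M[R]_n :=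
  (1%:M - M) *m invmx (1%:M + M).

Definition diag_expmx (R : realType) (n : nat) (d : 'rV[R]_n) : 'M[R]_n :=
  diag_mx (map_mx expR d).

(* The values taken by the coefficient function at one scheduling point. *)
Record ss_coef (R : realType) (nx nu ny : nat) := SSCoef {
  ssA : 'M[R]_(nx, nx);
  ssB : 'M[R]_(nx, nu);
  ssC : 'M[R]_(ny, nx);
  ssD : 'M[R]_(ny, nu);
  ssb : 'cV[R]_(nx + ny)
}.

Definition lpv_trajectory (R : realType) (np nx nu ny : nat)
    (P : set 'cV[R]_np) (psi : P -> ss_coef R nx nu ny)
    (p : nat -> P) (u : nat -> 'cV[R]_nu)
    (x : nat -> 'cV[R]_nx) (y : nat -> 'cV[R]_ny) : Prop :=
  forall t : nat,
    col_mx (x t.+1) (y t) =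
      block_mx (ssA (psi (p t))) (ssB (psi (p t)))
               (ssC (psi (p t))) (ssD (psi (p t))) *m col_mx (x t) (u t)
      + ssb (psi (p t)).

Definition stability_condition (R : realType) (np nx nu ny : nat)
    (P : set 'cV[R]_np) (psi : P -> ss_coef R nx nu ny) : Prop :=
  exists (XX : 'M[R]_nx) (alpha : R),
    [/\ posdefmx XX, 0 < alpha <= 1 &
      forall p : P,
        posdefmx (alpha ^+ 2 *: XX - (ssA (psi p))^T *m XX *m ssA (psi p))].

Definition Nmx (R : realType) (n : nat) (X Y : 'M[R]_n) (eps : R) : 'M[R]_n :=
  X^T *m X + Y - Y^T + eps%:M.

(* The positive constant eps of N(p) is chosen at each p, like X(p) and Y(p).
   A single eps for all p would not be equivalent to the stability condition,
   which is only pointwise in p: for P = ]0, 1[, nx = 1 and A(p) = p, it holds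
   with XX = alpha = 1, while N(p) >= eps forces
   A(p) <= (1 - eps) / (1 + eps). *)
Definition stable_parametrization (R : realType) (np nx nu ny : nat)
    (P : set 'cV[R]_np) (psi : P -> ss_coef R nx nu ny) : Prop :=
  exists (d : 'rV[R]_nx) (alpha : R) (YY : 'M[R]_nx)
         (phi : P -> 'M[R]_nx * 'M[R]_nx),
    0 < alpha <= 1 /\
    forall p : P, exists2 eps : R, 0 < eps &
      let Lambda := diag_expmx d in
      let Q := cayley (YY - YY^T) in
      let M := cayley (Nmx (phi p).1 (phi p).2 eps) in
      ssA (psi p) = alpha *: (Q *m invmx Lambda *m M *m Lambda *m Q^T).

(* Main.v *)
Require Import Defs.
From HB Require Import structures.
From mathcomp Require Import all_boot all_order all_algebra.
From mathcomp Require Import all_classical all_reals all_analysis.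
From mathcomp Require Import complex ring.

Set Implicit Arguments.
Unset Strict Implicit.
Unset Printing Implicit Defensive.

Import Order.TTheory GRing.Theory Num.Theory.
Local Open Scope ring_scope.

(* If A = alpha T^-1 M T with T invertible, then XX = T^T T turns
   alpha^2 XX - A^T XX A into alpha^2 T^T (1 - M^T M) T, so the stability
   condition says that M is a strict contraction. Since
     (1 + N)^T (1 - cayley(N)^T cayley(N)) (1 + N) = 2 (N + N^T)
   and cayley is an involution, strict contractions are exactly the cayley(N)
   with N + N^T positive definite, i.e. N = X^T X + Y - Y^T + eps; likewise
   orthogonal Q with 1 + Q invertible are the cayley transforms of skew
   matrices. Conversely a positive definite XX equals Q diag Q^T, and flipping
   signs of the columns of Q makes 1 + Q invertible without changing XX. *)

(** * Linear algebra preliminaries *)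

Lemma symmetricmx_trE (R : fieldType) (n : nat) (S : 'M[R]_n) :
  (S \is symmetricmx) = (S^T == S).
Proof.
rewrite qualifE /= expr0 scale1r (_ : map_mx idfun S^T = S^T) 1?eq_sym //.
by apply/matrixP => i j; rewrite !mxE.
Qed.

Lemma unitmx_ker0 (R : fieldType) (n : nat) (A : 'M[R]_n) :
  (forall v : 'cV[R]_n, A *m v = 0 -> v = 0) -> A \in unitmx.
Proof.
move=> kerA0; rewrite -unitmx_tr -row_free_unit -kermx_eq0.
apply/eqP/row_matrixP => i; rewrite row0.
have : row i (kermx A^T) *m A^T = 0 by rewrite -row_mul mulmx_ker row0.
move=> /(congr1 trmx); rewrite trmx_mul trmxK trmx0 => /kerA0.
by move=> /(congr1 trmx); rewrite trmxK trmx0.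
Qed.

Section SquaredNorm.
Variables (R : realFieldType) (n : nat).
Implicit Type v : 'cV[R]_n.

Lemma sqnorm_ge0 v : 0 <= (v^T *m v) 0 0.
Proof.
by rewrite mxE sumr_ge0 // => i _; rewrite !mxE -expr2 sqr_ge0.
Qed.

Lemma sqnorm_gt0 v : v != 0 -> 0 < (v^T *m v) 0 0.
Proof.
move=> v0; rewrite lt_neqAle sqnorm_ge0 andbT eq_sym.
apply: contra_neq v0; rewrite mxE => /psumr_eq0P v0.
apply/colP => i; rewrite mxE; apply/eqP; rewrite -sqrf_eq0 expr2.
apply/eqP; rewrite -[RHS](v0 _ i) ?mxE // => j _.
by rewrite !mxE -expr2 sqr_ge0.
Qed.

End SquaredNorm.

(** * Real spectral theorem *)

(* The complex spectral theorem, applied to A over R[i], gives a real eigenvalue. *)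
Lemma symmetric_eigenvalue (R : rcfType) (n : nat) (A : 'M[R]_n.+1) :
  A^T = A -> exists a, eigenvalue A a.
Proof.
move=> symA; pose f := real_complex R.
have symfA : map_mx f A \is hermsymmx.
  apply: realsym_hermsym.
    by rewrite symmetricmx_trE map_trmx symA.
  apply/mxOverP => i j; rewrite mxE.
  by apply/complex_realP; exists (A i j).
have /mxOverP/(_ 0 0)/complex_realP[a ea] := hermitian_spectral_diag_real symfA.
(* Eigenvalues are roots of the characteristic polynomial, which commutes with the embedding [f], so
   it suffices to find an eigenvector over [R[i]]: row 0 of the unitary [P]. *)
exists a; rewrite eigenvalue_root_char -(fmorph_root f) map_char_poly.
rewrite -eigenvalue_root_char.
have /orthomx_spectralP := hermitian_normalmx symfA.
set P := spectralmx _; set d := spectral_diag _ in ea * => defA.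
have unitP : P \in unitmx by apply: spectral_unit.
apply/eigenvalueP; exists (row 0 P).
  rewrite defA -!row_mul !mulmxA mulmxV // mul1mx row_mul row_diag_mx ea.
  by rewrite -scalemxAl -rowE.
apply/eqP => P0; have := unitP; rewrite -row_free_unit => /row_free_inj inj.
have /matrixP/(_ 0 0) : @delta_mx R[i] 1 n.+1 0 0 = 0.
  by apply: inj; rewrite -rowE P0 mul0mx.
by rewrite !mxE !eqxx => /eqP; rewrite oner_eq0.
Qed.

(* The witness is the Householder reflection in the direction v - e_0. *)
Lemma exists_reflection (R : rcfType) (n : nat) (v : 'rV[R]_n.+1) :
  v *m v^T = 1%:M ->
  exists H : 'M[R]_n.+1, [/\ H^T = H, H *m H = 1%:M & delta_mx 0 0 *m H = v].
Proof.
move=> vv1; pose e : 'rV[R]_n.+1 := delta_mx 0 0.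
have [->|vNe] := eqVneq v e; first by exists 1%:M; rewrite trmx1 !mulmx1.
pose w := v - e; pose c := (w *m w^T) 0 0.
have ee : e *m e^T = 1%:M.
  by rewrite trmx_delta mul_delta_mx; apply/matrixP => i j; rewrite !mxE !ord1.
have ve : v *m e^T = (v 0 0)%:M.
  by rewrite trmx_delta -colE; apply/matrixP => i j; rewrite !mxE !ord1.
have ev : e *m v^T = (v 0 0)%:M by rewrite -[LHS]trmxK trmx_mul trmxK ve tr_scalar_mx.
have cE : w *m w^T = c%:M by apply: mx11_scalar.
have c_gt0 : 0 < c.
  have := @sqnorm_gt0 _ _ w^T; rewrite trmxK; apply.
  by rewrite trmx_eq0 subr_eq0.
(* Both [v] and [e] are unit vectors, so [e w^T = v 0 0 - 1 = - c / 2], and the reflection sends [e]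
   to [e + w = v]. *)
have ecE : c = 2 * (1 - v 0 0).
  rewrite /c /w linearB /= mulmxBl !mulmxBr vv1 ee ve ev !mxE /= mulr1n; ring.
have ew : e *m w^T = (- (c / 2))%:M.
  rewrite /w linearB /= mulmxBr ee ev -raddfB /= ecE; congr _%:M; by field.
exists (1%:M - (2 / c) *: (w^T *m w)); split.
- by rewrite linearB linearZ /= trmx1 trmx_mul trmxK.
- have : w^T *m w *m (w^T *m w) = c *: (w^T *m w).
    by rewrite mulmxA -[_ *m w^T]mulmxA cE mul_mx_scalar scalemxAl.
  move: (w^T *m w) => P PP.
  rewrite mulmxBl !mulmxBr !mul1mx mulmx1 -scalemxAl -scalemxAr PP !scalerA.
  have -> : 2 / c * (2 / c) * c = 2 / c + 2 / c by field; rewrite gt_eqF.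
  by rewrite scalerDl opprB addrK subrK.
- rewrite mulmxBr mulmx1 -scalemxAr mulmxA ew mul_scalar_mx scalerA.
  rewrite (_ : 2 / c * _ = -1) ?scaleN1r ?opprK 1?addrC ?subrK //.
  by field; rewrite gt_eqF.
Qed.

(** Deflation: a reflection carrying [e_0] to a unit eigenvector splits off a 1 by 1 block, and
    induction diagonalizes the remaining symmetric block. *)
Theorem symmetric_spectral (R : rcfType) (n : nat) (S : 'M[R]_n) : S^T = S ->
  exists (Q : 'M[R]_n) (d : 'rV[R]_n),
    Q^T *m Q = 1%:M /\ S = Q *m diag_mx d *m Q^T.
Proof.
elim: n S => [|n IHn] S symS.
  by exists 1%:M, 0; split; apply/matrixP => -[].
have [a /eigenvalueP[u uS u0]] := symmetric_eigenvalue symS.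
pose c := (u *m u^T) 0 0.
have c_gt0 : 0 < c.
  by have := @sqnorm_gt0 _ _ u^T; rewrite trmxK; apply; rewrite trmx_eq0.
pose v := (Num.sqrt c)^-1 *: u.
have vv : v *m v^T = 1%:M.
  rewrite linearZ /= -scalemxAl -scalemxAr scalerA [u *m _]mx11_scalar -/c.
  rewrite scale_scalar_mx -invfM -expr2 sqr_sqrtr ?ltW // mulVf ?gt_eqF //.
have vS : v *m S = a *: v by rewrite -scalemxAl uS !scalerA mulrC.
have [H [symH HH eH]] := exists_reflection vv.
(* The size [1 + n] gives access to the block decomposition of the conjugate. *)
have [S' S'E] : exists S' : 'M[R]_(1 + n), S' = H *m S *m H by eexists.
have symS' : S'^T = S' by rewrite S'E !trmx_mul symH symS mulmxA.
(* Row 0 of [H S H] is [v S H = a v H = a e_0], since [e_0 H = v] and [H H = 1]. *)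
have rowS' : row 0 S' = a *: delta_mx 0 0.
  rewrite rowE S'E !mulmxA eH vS -scalemxAl -eH -mulmxA HH mulmx1 //.
pose D := drsubmx S'.
have urS' : ursubmx S' = 0.
  apply/rowP => j; have /rowP/(_ (rshift 1 j)) := rowS'.
  rewrite !mxE /= mulr0 => <-; congr (S' _ _); exact/val_inj.
have dlS' : dlsubmx S' = 0.
  by rewrite -[S']symS' -trmx_ursub urS' trmx0.
have ulS' : ulsubmx S' = a%:M.
  rewrite [LHS]mx11_scalar; congr _%:M; have /rowP/(_ 0) := rowS'.
  rewrite !mxE eqxx mulr1 => <-; congr (S' _ _); exact/val_inj.
have [Q [d [QQ DE]]] : exists (Q : 'M[R]_n) (d : 'rV[R]_n),
    Q^T *m Q = 1%:M /\ D = Q *m diag_mx d *m Q^T.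
  by apply: IHn; rewrite trmx_drsub symS'.
pose G : 'M[R]_(1 + n) := block_mx 1%:M 0 0 Q.
have trG : G^T = block_mx 1%:M 0 0 Q^T by rewrite tr_block_mx trmx1 !trmx0.
have GG : G^T *m G = 1%:M.
  rewrite trG mulmx_block !(mulmx0, mul0mx, addr0, add0r) QQ mulmx1.
  by rewrite -scalar_mx_block.
have S'G : S' = G *m diag_mx (row_mx a%:M d) *m G^T.
  rewrite trG -[LHS]submxK urS' dlS' ulS' -/D DE diag_mx_row !mulmx_block.
  rewrite !(mulmx0, mul0mx, mulmx1, mul1mx, addr0, add0r); congr block_mx.
  by apply/matrixP => i j; rewrite !mxE !ord1.
exists (H *m G), (row_mx a%:M d); split.
  by rewrite trmx_mul symH mulmxA -[_ *m H *m H]mulmxA HH mulmx1.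
rewrite trmx_mul symH; transitivity (H *m S' *m H); last by rewrite S'G !mulmxA.
by rewrite S'E !mulmxA HH mul1mx -mulmxA HH mulmx1.
Qed.

(** * Making a matrix invertible by a diagonal of signs *)

(* Induction on n: the determinant is affine in the first sign, with slope the
   determinant of the shifted minor, so it cannot vanish at both 1 and -1. *)
Theorem sign_shift_unitmx (R : numFieldType) (n : nat) (A : 'M[R]_n) :
  exists2 s : 'rV[R]_n, (forall i, s 0 i ^+ 2 = 1) & diag_mx s + A \in unitmx.
Proof.
elim: n A => [|n IHn] A.
  by exists 0 => [[]//|]; rewrite unitmxE det_mx00 unitr1.
have [s s2 unit_s] := IHn (row' 0 (col' 0 A)).
pose st t : 'rV[R]_n.+1 := \row_j oapp (s 0) t (unlift 0 j).
pose M t := diag_mx (st t) + A.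
(* Only row 0 depends on [t], so the cofactors along it do not. *)
have row'M t u : row' 0 (M t) = row' 0 (M u).
  apply/matrixP => i j; rewrite !mxE.
  have [<-|//] := eqVneq (lift 0 i) j.
  by rewrite !liftK.
have detM t : \det (M t) = \det (M 0) + t * \det (diag_mx s + row' 0 (col' 0 A)).
  have cofM j : cofactor (M t) 0 j = cofactor (M 0) 0 j.
    rewrite /cofactor; congr (_ * \det _); apply/matrixP => i k.
    by have /matrixP/(_ i (lift j k)) := row'M t 0; rewrite !mxE.
  rewrite !(expand_det_row _ 0) !big_ord_recl cofM addrAC; congr (_ + _).
    rewrite !mxE unlift_none /= mul0rn add0r mulrDl addrC mulr1n; congr (_ + _).
    congr (_ * _).
    rewrite /cofactor expr0 mul1r; congr (\det _); apply/matrixP => i j.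
    by rewrite !mxE liftK (inj_eq lift_inj).
  by apply: eq_bigr => j _; rewrite cofM !mxE /=.
have st2 t : t ^+ 2 = 1 -> forall i, st t 0 i ^+ 2 = 1.
  by move=> t2 i; rewrite mxE; case: unliftP => [j _|_] /=.
have [M1|] := eqVneq (\det (M 1)) 0; last first.
  by exists (st 1); [exact: st2 (expr1n _ _) | rewrite unitmxE unitfE].
exists (st (-1)); first by apply: st2; rewrite sqrrN expr1n.
(* If the determinant vanishes at 1, its value at -1 is -2 times the minor, nonzero by induction. *)
rewrite unitmxE unitfE (detM (-1)); move: M1; rewrite (detM 1) mul1r => /eqP.
rewrite addr_eq0 => /eqP->; rewrite mulN1r -opprD oppr_eq0 -mulr2n mulrn_eq0.
by rewrite -unitfE -unitmxE.
Qed.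

(** * Positive definite matrices and congruence *)

Section PositiveDefinite.
Variables (R : realType) (n : nat).
Implicit Types S T A M N Q X Y K : 'M[R]_n.

Lemma posdefmx_congr S T :
  T \in unitmx -> posdefmx S -> posdefmx (T^T *m S *m T).
Proof.
move=> unitT [symS posS]; split.
  move: symS; rewrite !symmetricmx_trE => /eqP symS.
  by rewrite !trmx_mul trmxK symS mulmxA.
move=> v v0.
have -> : v^T *m (T^T *m S *m T) *m v = (T *m v)^T *m S *m (T *m v).
  by rewrite trmx_mul !mulmxA.
apply: posS; apply: contra_neq v0 => /(congr1 (mulmx (invmx T))).
by rewrite mulmxA mulVmx // mul1mx mulmx0.
Qed.

Lemma posdefmx_congrE S T :
  T \in unitmx -> posdefmx (T^T *m S *m T) <-> posdefmx S.
Proof.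
move=> unitT; split; last exact: posdefmx_congr.
have unitV : invmx T \in unitmx by rewrite unitmx_inv.
move=> /(posdefmx_congr unitV).
by rewrite !mulmxA -trmx_mul mulmxV // trmx1 mul1mx mulmxK.
Qed.

Lemma posdefmxZ S c : 0 < c -> posdefmx (c *: S) <-> posdefmx S.
Proof.
move=> c0; rewrite /posdefmx !symmetricmx_trE linearZ /=.
rewrite (inj_eq (scalerI (lt0r_neq0 c0))).
have formZ v : (v^T *m (c *: S) *m v) 0 0 = c * (v^T *m S *m v) 0 0.
  by rewrite -scalemxAr -scalemxAl mxE.
by split=> -[-> posS]; split=> // v /posS; rewrite formZ pmulr_rgt0.
Qed.

Lemma posdefmx_diag (d : 'rV[R]_n) : posdefmx (diag_mx d) -> forall i, 0 < d 0 i.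
Proof.
move=> [_ posd] i; have := posd (delta_mx i 0).
rewrite trmx_delta -rowE -colE !mxE eqxx mulr1n; apply.
by apply/eqP => /matrixP/(_ i 0)/eqP; rewrite !mxE !eqxx oner_eq0.
Qed.

Lemma posdefmx_spectrum_gt0 Q (d : 'rV[R]_n) : Q^T *m Q = 1%:M ->
  posdefmx (Q *m diag_mx d *m Q^T) -> forall i, 0 < d 0 i.
Proof.
move=> QQ posS; apply: posdefmx_diag; have [_ unitQ] := mulmx1_unit QQ.
by move: (posdefmx_congr unitQ posS); rewrite !mulmxA QQ mul1mx -mulmxA QQ mulmx1.
Qed.

(** A kernel vector [v] satisfies [N v = - v], so the form of [N + N^T] at [v] is minus twice its
    squared norm. *)
Lemma unitmx_accretive N :
  (forall v : 'cV[R]_n, 0 <= (v^T *m (N + N^T) *m v) 0 0) ->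
  1%:M + N \in unitmx.
Proof.
move=> ge0N; apply: unitmx_ker0 => v; rewrite mulmxDl mul1mx => /eqP.
rewrite addrC addr_eq0 => /eqP Nv; apply: contraTeq (ge0N v) => v0.
have -> : v^T *m (N + N^T) *m v = v^T *m (N *m v) + (N *m v)^T *m v.
  by rewrite mulmxDr mulmxDl trmx_mul !mulmxA.
rewrite -ltNge Nv [(- v)^T]linearN /= mulmxN mulNmx -opprD mxE oppr_lt0 mxE.
by rewrite addr_gt0 ?sqnorm_gt0.
Qed.

(** A kernel vector satisfies [M v = - v], so [M] preserves its norm, which a strict contraction
    does only at 0. *)
Lemma unitmx_contraction M : posdefmx (1%:M - M^T *m M) -> 1%:M + M \in unitmx.
Proof.
move=> [_ posM]; apply: unitmx_ker0 => v; rewrite mulmxDl mul1mx => /eqP.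
rewrite addrC addr_eq0 => /eqP Mv; apply: contraTeq isT => /posM.
have -> : v^T *m (1%:M - M^T *m M) *m v = v^T *m v - (M *m v)^T *m (M *m v).
  by rewrite mulmxBr mulmxBl mulmx1 trmx_mul !mulmxA.
by rewrite Mv [(- v)^T]linearN /= mulNmx mulmxN opprK subrr mxE ltxx.
Qed.

(** * The Cayley transform *)

Lemma cayley_mulr N : 1%:M + N \in unitmx -> cayley N *m (1%:M + N) = 1%:M - N.
Proof. by move=> unitN; rewrite mulmxKV. Qed.

(** Multiplying by [1 + N] clears the inverses, leaving [(1 + N)^T (1 + N) - (1 - N)^T (1 - N)]. *)
Lemma cayley_gram N : 1%:M + N \in unitmx ->
  (1%:M + N)^T *m (1%:M - (cayley N)^T *m cayley N) *m (1%:M + N)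
  = 2 *: (N + N^T).
Proof.
move=> unitN; rewrite mulmxBr mulmxBl mulmx1 mulmxA -trmx_mul -mulmxA.
rewrite cayley_mulr // [(1%:M + N)^T]linearD [(1%:M - N)^T]linearB /= trmx1.
rewrite mulmxBl !mulmxBr mulmxDl !mulmxDr !mul1mx !mulmx1.
by move: (N^T *m N) N^T => P N'; apply/matrixP => i j; rewrite !mxE; ring.
Qed.

(** With [V] the inverse of [1 + M], [cayley M = 2 V - 1]. Hence [1 + cayley M = 2 V] is invertible
    and [1 - cayley M = 2 (1 - V) = 2 M V]. *)
Lemma cayleyK M : 1%:M + M \in unitmx ->
  1%:M + cayley M \in unitmx /\ cayley (cayley M) = M.
Proof.
move=> unitM; pose V := invmx (1%:M + M).
have cM : cayley M = 2 *: V - 1%:M.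
  rewrite -(mulmxV unitM) -/V scaler_nat mulr2n.
  rewrite -{1 2}[V]mul1mx -mulmxDl -mulmxBl; congr (_ *m _).
  by rewrite opprD addrA addrK.
have V2 : 1%:M + cayley M = 2 *: V by rewrite cM addrC subrK.
have unitV2 : 2 *: V \in unitmx.
  by rewrite unitmxZ ?unitmx_inv // unitfE pnatr_eq0.
split; first by rewrite V2.
rewrite {1}/cayley V2 cM; apply: (can_inj (mulmxK unitV2)).
rewrite mulmxKV // opprB addrA -mulr2n -scaler_nat -scalemxAr.
rewrite -scalerBr; congr (_ *: _); rewrite -(mulmxV unitM) -/V mulmxDl mul1mx.
by rewrite addrC addKr.
Qed.

Lemma cayley_skew K : K^T = - K -> (cayley K)^T *m cayley K = 1%:M.
Proof.
move=> skewK; have unitK : 1%:M + K \in unitmx.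
  by apply: unitmx_accretive => v; rewrite skewK subrr mulmx0 mul0mx mxE.
have := cayley_gram unitK; rewrite skewK subrr scaler0.
move=> /(congr1 (fun B => B *m invmx (1%:M + K))); rewrite mulmxK // mul0mx.
move=> /(congr1 (mulmx (invmx (1%:M + K)^T))); rewrite mulKmx ?unitmx_tr //.
by rewrite mulmx0 => /eqP; rewrite subr_eq0 => /eqP.
Qed.

(** This is [cayley_gram] at [N = cayley Q]: its left side vanishes because the transform of [N] is
    the orthogonal [Q]. *)
Lemma cayley_orthogonal Q : 1%:M + Q \in unitmx -> Q^T *m Q = 1%:M ->
  (cayley Q)^T = - cayley Q.
Proof.
move=> /cayleyK[unitN cN] QQ; apply/eqP; rewrite -addr_eq0 addrC.
have := cayley_gram unitN; rewrite cN QQ subrr mulmx0 mul0mx => /esym/eqP.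
by rewrite scaler_eq0 pnatr_eq0.
Qed.

Lemma posdefmx_cayley N : 1%:M + N \in unitmx ->
  posdefmx (1%:M - (cayley N)^T *m cayley N) <-> posdefmx (N + N^T).
Proof.
move=> unitN; rewrite -(posdefmx_congrE _ unitN) cayley_gram //.
exact: posdefmxZ.
Qed.

(** * Strict contractions as transforms of [Nmx] *)

Lemma posdefmx_gram_shift S : posdefmx S ->
  exists X (eps : R), 0 < eps /\ S = X^T *m X + eps%:M.
Proof.
move=> posS; have := posS; rewrite /posdefmx symmetricmx_trE => -[/eqP symS _].
have [Q [d [QQ defS]]] := symmetric_spectral symS.
have QQ' := mulmx1C QQ.
have d_gt0 : forall i, 0 < d 0 i.
  by apply: posdefmx_spectrum_gt0 QQ _; rewrite -defS.
(* The smallest eigenvalue capped at 1; the cap also keeps [eps] positive when [n = 0]. What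
   remains, [d - eps], is nonnegative and has a square root. *)
pose eps := \big[Num.min/1]_i d 0 i.
have eps_gt0 : 0 < eps by apply: lt_bigmin => // i _; apply: d_gt0.
pose r := \row_i Num.sqrt (d 0 i - eps).
exists (diag_mx r *m Q^T), eps; split => //.
have -> : eps%:M = Q *m diag_mx (const_mx eps) *m Q^T.
  by rewrite diag_const_mx mul_mx_scalar -scalemxAl QQ' scalemx1.
rewrite trmx_mul trmxK tr_diag_mx mulmxA -[Q *m _ *m diag_mx r]mulmxA mulmx_diag.
rewrite -mulmxDl -mulmxDr -linearD /= defS; congr (_ *m _ *m _).
congr diag_mx; apply/rowP => i; rewrite !mxE -expr2 sqr_sqrtr ?subrK //.
by rewrite subr_ge0 bigmin_le.
Qed.

Lemma Nmx_addtr X Y eps :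
  Nmx X Y eps + (Nmx X Y eps)^T = 2 *: (X^T *m X + eps%:M).
Proof.
have -> : (Nmx X Y eps)^T = X^T *m X + Y^T - Y + eps%:M.
  by rewrite /Nmx !linearD linearN /= trmx_mul !trmxK tr_scalar_mx.
rewrite /Nmx; move: (X^T *m X) Y^T => P Y'.
by apply/matrixP => i j; rewrite !mxE; ring.
Qed.

(** The skew part of [Nmx] cancels, the Gram term is nonnegative, and [eps] makes the form
    strict. *)
Lemma posdefmx_Nmx X Y eps : 0 < eps ->
  posdefmx (Nmx X Y eps + (Nmx X Y eps)^T).
Proof.
move=> eps0; rewrite Nmx_addtr; apply/posdefmxZ => //; split.
  by rewrite symmetricmx_trE linearD /= trmx_mul trmxK tr_scalar_mx.
move=> v v0.
have -> : v^T *m (X^T *m X + eps%:M) *m v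
    = (X *m v)^T *m (X *m v) + eps *: (v^T *m v).
  by rewrite mulmxDr mulmxDl trmx_mul !mulmxA mul_mx_scalar scalemxAl.
by rewrite mxE [X in _ + X]mxE ltr_wpDl ?sqnorm_ge0 ?mulr_gt0 ?sqnorm_gt0.
Qed.

Lemma posdefmx_cayley_Nmx X Y eps : 0 < eps ->
  let M := cayley (Nmx X Y eps) in posdefmx (1%:M - M^T *m M).
Proof.
move=> eps0 M; have posN := posdefmx_Nmx X Y eps0.
apply/posdefmx_cayley => //; apply: unitmx_accretive => v.
have [->|v0] := eqVneq v 0; first by rewrite mulmx0 mxE.
by apply: ltW; apply: posN.2.
Qed.

Lemma contraction_cayley_Nmx M : posdefmx (1%:M - M^T *m M) ->
  exists (XY : 'M[R]_n * 'M[R]_n) (eps : R),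
    0 < eps /\ M = cayley (Nmx XY.1 XY.2 eps).
Proof.
move=> posM; have [unitN cN] := cayleyK (unitmx_contraction posM).
set N := cayley M in unitN cN.
have half_gt0 : 0 < 2^-1 :> R by rewrite invr_gt0.
have : posdefmx (2^-1 *: (N + N^T)).
  by apply/posdefmxZ => //; apply/(posdefmx_cayley unitN); rewrite cN.
move=> /posdefmx_gram_shift[X [eps [eps0 defX]]].
(* The symmetric part of [N] supplies [X] and [eps]; taking [Y = N / 2] makes [Y - Y^T] its skew
   part. *)
exists (X, 2^-1 *: N), eps; split=> //=; rewrite -[LHS]cN; congr cayley.
rewrite /Nmx linearZ /= [RHS]addrC addrA addrA [_%:M + _]addrC -defX.
by apply/matrixP => i j; rewrite !mxE; field.
Qed.

(** * Similarity, and orthogonal factors in Cayley form *)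

Lemma scaled_similarityK (alpha : R) T A : alpha != 0 -> T \in unitmx ->
  alpha *: (invmx T *m (alpha^-1 *: (T *m A *m invmx T)) *m T) = A.
Proof.
move=> alpha0 unitT; rewrite -scalemxAr -scalemxAl scalerA mulfV // scale1r.
by rewrite !mulmxA mulVmx // mul1mx mulmxKV.
Qed.

Lemma stability_similarity (alpha : R) T M A : 0 < alpha -> T \in unitmx ->
  A = alpha *: (invmx T *m M *m T) ->
  posdefmx (alpha ^+ 2 *: (T^T *m T) - A^T *m (T^T *m T) *m A)
  <-> posdefmx (1%:M - M^T *m M).
Proof.
move=> alpha0 unitT defA.
have TA : T *m A = alpha *: (M *m T).
  by rewrite defA -scalemxAr !mulmxA mulmxV // mul1mx.
have -> : alpha ^+ 2 *: (T^T *m T) - A^T *m (T^T *m T) *m A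
    = alpha ^+ 2 *: (T^T *m (1%:M - M^T *m M) *m T).
  have -> : A^T *m (T^T *m T) *m A = (T *m A)^T *m (T *m A).
    by rewrite trmx_mul !mulmxA.
  rewrite TA [(alpha *: _)^T]linearZ /= -scalemxAl -scalemxAr scalerA -expr2.
  by rewrite -scalerBr mulmxBr mulmxBl mulmx1 trmx_mul !mulmxA.
by apply: iff_trans (posdefmxZ _ _) (posdefmx_congrE _ unitT); rewrite exprn_gt0.
Qed.

Theorem symmetric_cayley_spectral S : S^T = S ->
  exists Y (d : 'rV[R]_n), let Q := cayley (Y - Y^T) in
    Q^T *m Q = 1%:M /\ S = Q *m diag_mx d *m Q^T.
Proof.
move=> /symmetric_spectral[Q0 [d [QQ0 ->]]].
have [s s2 unit_s] := sign_shift_unitmx Q0; pose D := diag_mx s.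
have DD : D *m D = 1%:M.
  rewrite mulmx_diag -diag_const_mx; congr diag_mx.
  by apply/rowP => i; rewrite !mxE -expr2 s2.
have trD : D^T = D by rewrite tr_diag_mx.
(* As [D D = 1], [1 + Q0 D = (D + Q0) D], where [D + Q0] is invertible by the choice of signs. *)
pose Q := Q0 *m D; have unitQ : 1%:M + Q \in unitmx.
  rewrite -DD -mulmxDl unitmx_mul unit_s; exact: (mulmx1_unit DD).1.
have QQ : Q^T *m Q = 1%:M.
  by rewrite trmx_mul trD mulmxA -[_ *m Q0]mulmxA QQ0 mulmx1.
(* Since [cayley Q] is skew, half of it as [Y] gives [Y - Y^T = cayley Q], whose transform is [Q]
   again. *)
have trK := cayley_orthogonal unitQ QQ; exists (2^-1 *: cayley Q), d.
have -> : 2^-1 *: cayley Q - (2^-1 *: cayley Q)^T = cayley Q.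
  rewrite [_^T]linearZ /= trK; move: (cayley Q) => K.
  by apply/matrixP => i j; rewrite !mxE; field.
rewrite (cayleyK unitQ).2; split=> //.
rewrite trmx_mul trD !mulmxA -[Q0 *m D *m _]mulmxA diag_mx_comm mulmxA.
by rewrite -[Q0 *m _ *m D *m D]mulmxA DD mulmx1.
Qed.

End PositiveDefinite.

(** * The factor [T] and the equivalence *)

Lemma trmx_diag_expmx (R : realType) (n : nat) (d : 'rV[R]_n) :
  (diag_expmx d)^T = diag_expmx d.
Proof. exact: tr_diag_mx. Qed.

Lemma unitmx_diag_expmx (R : realType) (n : nat) (d : 'rV[R]_n) :
  diag_expmx d \in unitmx.
Proof.
rewrite unitmxE det_diag unitfE; apply/prodf_neq0 => i _.
by rewrite mxE gt_eqF ?expR_gt0.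
Qed.

(** Halving the logarithms yields the positive square root of [diag_mx d], the form of [Lambda]
    needed to factor [XX] as [T^T T]. *)
Lemma diag_expmx_ln (R : realType) (n : nat) (d : 'rV[R]_n) :
  (forall i, 0 < d 0 i) ->
  let L := diag_expmx (\row_i (ln (d 0 i) / 2)) in L *m L = diag_mx d.
Proof.
move=> d0; rewrite /diag_expmx mulmx_diag; congr diag_mx; apply/rowP => i.
by rewrite !mxE -expRD -splitr lnK ?posrE.
Qed.

(** This [T] turns the product in the parametrization into the similarity [T^-1 M T]. *)
Lemma orthogonal_diag_factor (R : realType) (n : nat) (d : 'rV[R]_n)
    (Q : 'M[R]_n) : Q^T *m Q = 1%:M ->
  let L := diag_expmx d in let T := L *m Q^T in
  [/\ T \in unitmx, invmx T = Q *m invmx L & T^T *m T = Q *m (L *m L) *m Q^T].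
Proof.
move=> QQ L T; have unitL : L \in unitmx := unitmx_diag_expmx d.
have QLT : Q *m invmx L *m T = 1%:M.
  by rewrite mulmxA mulmxKV // (mulmx1C QQ).
have [_ unitT] := mulmx1_unit QLT; split => //.
  by apply: (can_inj (mulmxK unitT)); rewrite mulVmx // QLT.
by rewrite trmx_mul trmxK trmx_diag_expmx !mulmxA.
Qed.

Theorem theorem1 (R : realType) (np nx nu ny : nat) (P : set 'cV[R]_np)
    (psi : P -> ss_coef R nx nu ny) :
  stability_condition psi <-> stable_parametrization psi.
Proof.
split=> [[XX [alpha [posX /andP[alpha0 alpha1] stabA]]]|].
  have := posX; rewrite /posdefmx symmetricmx_trE => -[/eqP symX _].
  have [YY [d [QQ defX]]] := symmetric_cayley_spectral symX.
  set Q := cayley _ in QQ defX.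
  have d0 : forall i, 0 < d 0 i.
    by apply: posdefmx_spectrum_gt0 QQ _; rewrite -defX.
  pose l := \row_i (ln (d 0 i) / 2).
  have [unitT invT TT] := orthogonal_diag_factor l QQ.
  set T := diag_expmx l *m Q^T in unitT invT TT.
  have {}TT : T^T *m T = XX by rewrite TT diag_expmx_ln.
  pose M p := alpha^-1 *: (T *m ssA (psi p) *m invmx T).
  have AM p : ssA (psi p) = alpha *: (invmx T *m M p *m T).
    by rewrite scaled_similarityK ?gt_eqF.
  (* Choice collects [X(p)] and [Y(p)] into a mapping, while [eps] stays existential at each [p]. *)
  have /choice[phi phiP] p : exists XY : 'M[R]_nx * 'M[R]_nx,
      exists eps : R, 0 < eps /\ M p = cayley (Nmx XY.1 XY.2 eps).
    apply: contraction_cayley_Nmx.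
    by apply/(stability_similarity alpha0 unitT (AM p)); rewrite TT.
  exists l, alpha, YY, phi; split=> [|p]; first by rewrite alpha0.
  have [eps [eps0 defM]] := phiP p; exists eps => //=.
  by rewrite -defM AM invT /T !mulmxA.
move=> [d [alpha [YY [phi [/andP[alpha0 alpha1] defA]]]]].
set Q := cayley (YY - YY^T) in defA.
have QQ : Q^T *m Q = 1%:M.
  by apply: cayley_skew; rewrite linearB /= trmxK opprB.
have [unitT invT _] := orthogonal_diag_factor d QQ.
set T := diag_expmx d *m Q^T in unitT invT.
(* [T] is built from [d] and [YY] alone, so one matrix serves every [p]. *)
exists (T^T *m T), alpha; split; last 1 first.
- move=> p; have [eps eps0 /= Ap] := defA p.
  apply/(stability_similarity alpha0 unitT); last first.
    exact: (posdefmx_cayley_Nmx (phi p).1 (phi p).2 eps0).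
  by rewrite Ap invT /T !mulmxA.
- have [posI1 posI2] : posdefmx (1%:M : 'M[R]_nx).
    split=> [|v v0]; first by rewrite symmetricmx_trE trmx1.
    by rewrite mulmx1 sqnorm_gt0.
  by rewrite -[T^T]mulmx1; apply: posdefmx_congr.
- by rewrite alpha0.
Qed.
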